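(* For every integer $n \ge 1$ with binary representation $n = \sum_{i \ge 0} b_i 2^i$, $b_i \in \{0,1\}$, let $R(n) = \sum_{i \ge 0} b_i n^i$. Then $R(n) \equiv m(n-1) \pmod 2$ for all $n \ge 1$.
   Context: For a non-negative integer $k$, $s_2(k)$ denotes the number of ones in the binary expansion of $k$. Define $\bar{t}(k) = 1$ if $s_2(k)$ is even and $\bar{t}(k)=0$ if $s_2(k)$ is odd. The sequence $m(n)$, $n \ge 0$, is defined by $m(2k) = \bar{t}(k)$ and $m(2k+1) = 0$ for all $k \ge 0$. The sequence $R(n)$ is OEIS A104258 (replace $2^i$ with $n^i$ in the binary representation of $n$), indexed from $n=1$: $1,2,4,16,26,42,57,512,\ldots$. *)

(* Defs.v *)
From mathcomp Require Import all_boot.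
Set Implicit Arguments.
Unset Strict Implicit.
Unset Printing Implicit Defensive.

(* The coefficient b_i of 2 ^ i in the binary representation of n. *)
Definition bit (n i : nat) : nat := (n %/ 2 ^ i) %% 2.

(* Since n < 2 ^ n, all the binary digits of n of index i >= n vanish, so the
   sums over all i >= 0 below are written as sums over i < n; bit_large and
   binary_expansion justify this truncation. *)
Lemma bit_large (n i : nat) : n <= i -> bit n i = 0.
Proof.
move=> le_ni; rewrite /bit divn_small ?mod0n //.
exact: leq_ltn_trans le_ni (ltn_expl _ _).
Qed.

Lemma binary_expansion (n : nat) : n = \sum_(i < n) bit n i * 2 ^ i.
Proof.
have E k : n %/ 2 ^ k * 2 ^ k + \sum_(i < k) bit n i * 2 ^ i = n.
  elim: k => [|k IHk]; first by rewrite big_ord0 expn0 divn1 muln1 addn0.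
  rewrite big_ord_recr /= [X in _ + X]addnC addnA.
  suff -> : n %/ 2 ^ k.+1 * 2 ^ k.+1 + bit n k * 2 ^ k = n %/ 2 ^ k * 2 ^ k.
    exact: IHk.
  rewrite /bit expnSr divnMA [2 ^ k * 2]mulnC mulnA -mulnDl.
  by rewrite -divn_eq.
have n_lt : n < 2 ^ n by exact: ltn_expl.
by have := E n; rewrite (divn_small n_lt) mul0n add0n; exact: esym.
Qed.

Definition s2 (k : nat) : nat := \sum_(i < k) bit k i.

Definition tbar (k : nat) : nat := if odd (s2 k) then 0 else 1.

Definition seqm (n : nat) : nat := if odd n then 0 else tbar n./2.

(* The sequence is indexed from n = 1; the value at n = 0 is irrelevant. *)
Definition seqR (n : nat) : nat := \sum_(i < n) bit n i * n ^ i.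

(* Main.v *)
(* Modulo 2 every power n ^ i with i > 0 is congruent to n, and n ^ 0 = 1. So R n
   is congruent to the digit b_0 = 0 when n is even, and to s2 n when n is odd;
   in the latter case n = 2 k + 1 and s2 n = s2 k + 1. *)
Require Import Defs.
From mathcomp Require Import all_boot.

Lemma eq_odd_sum (n : nat) (F G : 'I_n -> nat) :
  (forall i, odd (F i) = odd (G i)) -> odd (\sum_(i < n) F i) = odd (\sum_(i < n) G i).
Proof.
by move=> eqFG; rewrite !(big_morph odd oddD (erefl (odd 0))); apply: eq_bigr.
Qed.

Lemma bit0 (n : nat) : bit n 0 = odd n.
Proof. by rewrite /bit divn1 modn2. Qed.

Lemma bitS (n i : nat) : bit n i.+1 = bit n./2 i.
Proof. by rewrite /bit expnS divnMA divn2. Qed.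

(** Digits of index at least [k] vanish, so a longer range adds only zeros. *)
Lemma sum_bit_widen (k m : nat) : k <= m -> \sum_(i < m) bit k i = s2 k.
Proof.
move=> le_km; rewrite /s2 [RHS](big_ord_widen m (bit k) le_km) [RHS]big_mkcond /=.
by apply: eq_bigr => i _; case: ltnP => // /bit_large.
Qed.

Lemma s2_doubleS (k : nat) : s2 k.*2.+1 = (s2 k).+1.
Proof.
rewrite {1}/s2 big_ord_recl bit0 /= odd_double add1n; congr _.+1.
(* With the lowest digit split off, [k.*2] terms remain, while [s2 k] has only [k]. *)
rewrite -(@sum_bit_widen k k.*2); last by rewrite -addnn leq_addr.
by apply: eq_bigr => i _; rewrite bitS /= uphalf_double.
Qed.

Lemma odd_seqR_even (n : nat) : ~~ odd n -> odd (seqR n) = false.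
Proof.
case: n => [|n] even_n; first by rewrite /seqR big_ord0.
rewrite /seqR (@eq_odd_sum _ _ (fun=> 0)) ?big1 // => -[[|i] lt_in] /=.
  by rewrite bit0 (negPf even_n).
by rewrite oddM oddX (negPf even_n) andbF.
Qed.

Lemma odd_seqR_odd (n : nat) : odd n -> odd (seqR n) = odd (s2 n).
Proof.
by move=> odd_n; apply: eq_odd_sum => i; rewrite oddM oddX odd_n orbT andbT.
Qed.

Theorem lemma7 (n : nat) : 1 <= n -> seqR n = seqm (n - 1) %[mod 2].
Proof.
case: n => // n _; rewrite subn1 /= !modn2 /seqm; congr nat_of_bool.
(* Here [n] is the index of [seqm]; [seqR] is taken at [n.+1], of opposite parity. *)
have [odd_n | even_n] := boolP (odd n); first by rewrite odd_seqR_even //= odd_n.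
rewrite odd_seqR_odd //= /tbar.
(* The extra one digit of [n.+1] over [n./2] flips the parity, as [tbar] does. *)
by rewrite -[in LHS](even_halfK even_n) s2_doubleS /=; case: (odd _).
Qed.
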